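(* Let $(T,S,\phi)$ be a planar tanglegram, and let $\mathscr{P}(T,S,\phi)$ denote its collection of planar layouts. Let the output of $\texttt{ModifiedUntangle}(T,S,\phi)$ be the layout $(X,Y)$ and the set $L$ of leaf-matched pairs. Then every $(X',Y')\in \mathscr{P}(T,S,\phi)$ can be obtained by starting with $(X,Y)$ and performing a sequence of paired flips at pairs $(u,v)\in L$.
   Context: **Trees and tanglegrams.** A rooted binary tree is a rooted tree in which every vertex has zero or two children; vertices with children are internal, the others are leaves. A tanglegram $(T,S,\phi)$ of size $n$ consists of rooted binary trees $T,S$ with leaves $t_1,\dots,t_n$ and $s_1,\dots,s_n$ and a bijection $\phi:[n]\to[n]$; the leaf $t_i$ is matched with $s_{\phi(i)}$, and the $(t_i,s_{\phi(i)})$ are the between-tree edges. Write $w'\le w$ if $w'=w$ or $w'$ is a descendant of $w$; $\operatorname{Lf}(w)$ is the set of leaves $\ell\le w$. **Layouts.** A layout is a pair $(X,Y)$ of ordered lists of the leaves of $T$ and of $S$ that arise as the top-to-bottom orders of the leaves in planar embeddings of the two trees (equivalently, for every vertex $w$, the leaves in $\operatorname{Lf}(w)$ appear consecutively). The edges $(t_i,s_{\phi(i)})$ and $(t_j,s_{\phi(j)})$ cross if $t_i$ is before $t_j$ in $X$ while $s_{\phi(i)}$ is after $s_{\phi(j)}$ in $Y$, or vice versa. A layout is planar if it has no crossings; a tanglegram is planar if it has a planar layout. **Flips.** A flip at an internal vertex $w$ reverses the consecutive sublist consisting of $\operatorname{Lf}(w)$ in the appropriate list. A pair of internal vertices $(u,v)$,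 $u\in T$, $v\in S$, is a leaf-matched pair if $\operatorname{Lf}(u)$ and $\operatorname{Lf}(v)$ are matched with each other by $\phi$. A paired flip at $(u,v)$ is a flip at $u$ together with a flip at $v$. **Algorithm ModifiedUntangle.** Input $(T,S,\phi)$. 1. For vertices $u\in T$, $v\in S$ let $P[u,v]$ be True iff some leaf in $\operatorname{Lf}(u)$ is matched by $\phi$ with a leaf in $\operatorname{Lf}(v)$. 2. Initialize ordered lists $X=(\text{root of }T)$, $Y=(\text{root of }S)$, edge set $E=\{(\text{root of }T,\text{root of }S)\}$, and $L=\emptyset$. 3. While $X\cup Y$ contains an internal vertex: choose an internal vertex $u$ in $X\cup Y$ of highest degree in the bipartite graph $(X,E,Y)$. If $u$ has degree 1, with unique neighbor $v$, add to $L$ the pair $(u,v)$ if $u\in T$, or $(v,u)$ if $u\in S$. Then refine $u$: let $B=(b_1,\dots,b_m)$ be the list ($X$ or $Y$) not containing $u$ and $u_1,u_2$ the children of $u$; for each $b_j$ adjacent to $u$, delete $(u,b_j)$ from $E$ and add $(u_i,b_j)$ for each $i\in\{1,2\}$ with $P[u_i,b_j]$ True. Let $k$ be the largest index with $(u_1,b_k)\in E$. If $j\ge k$ for all $(u_2,b_j)\in E$, replace $u$ by $u_1u_2$ in its list; otherwise replace $u$ by $u_2u_1$. 4. Return $(X,Y)$ and $L$. *)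

(* Defs.v *)
From HB Require Import structures.
From Stdlib Require Export Relation_Operators.
From mathcomp Require Export all_boot all_fingroup.

Set Implicit Arguments.
Unset Strict Implicit.
Unset Printing Implicit Defensive.

Inductive btree (n : nat) : Type :=
| Leaf of 'I_n
| Node of btree n & btree n.

Arguments Leaf {n} i.
Arguments Node {n} l r.

Lemma btree_comparable n : comparable (btree n).
Proof.
elim=> [i | l IHl r IHr] [j | l' r']; try by right.
- by case: (eqVneq i j) => [-> | /eqP ne]; [left | right=> -[]].
- case: (IHl l') => [-> | ne]; last by right=> -[].
  by case: (IHr r') => [-> | ne']; [left | right=> -[]].
Qed.

HB.instance Definition _ n := comparableMixin (@btree_comparable n).

Fixpoint Lf {n} (t : btree n) : seq 'I_n :=
  match t with
  | Leaf i => [:: i]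
  | Node l r => Lf l ++ Lf r
  end.

(* A vertex of a tree is represented by the subtree hanging from it: when the
   leaf labels are pairwise distinct, distinct vertices have distinct subtrees. *)
Fixpoint vertices {n} (t : btree n) : seq (btree n) :=
  t :: match t with
       | Leaf _ => [::]
       | Node l r => vertices l ++ vertices r
       end.

Definition internal {n} (t : btree n) : bool :=
  if t is Node _ _ then true else false.

(* The left/right order in [Node] carries no information: both enumerations
   of the two children of a vertex are allowed. *)
Definition children {n} (u u1 u2 : btree n) : bool :=
  (u == Node u1 u2) || (u == Node u2 u1).

(* The leaf [Leaf i] of [tgT] is t_i, and the leaf [Leaf i] of [tgS] is s_i. *)
Record tanglegram (n : nat) := Tanglegram {
  tgT : btree n;
  tgS : btree n;
  tgphi : {perm 'I_n};
  tgT_labels : perm_eq (Lf tgT) (enum 'I_n);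
  tgS_labels : perm_eq (Lf tgS) (enum 'I_n)
}.

Definition consecutive {A : eqType} (s X : seq A) : Prop :=
  exists p m q, X = p ++ m ++ q /\ perm_eq m s.

Definition tree_layout {n} (t : btree n) (X : seq 'I_n) : Prop :=
  perm_eq X (Lf t) /\ forall w, w \in vertices t -> consecutive (Lf w) X.

Definition layout {n} (Tg : tanglegram n) (XY : seq 'I_n * seq 'I_n) : Prop :=
  tree_layout (tgT Tg) XY.1 /\ tree_layout (tgS Tg) XY.2.

Definition before {A : eqType} (X : seq A) (a b : A) : bool :=
  index a X < index b X.

Definition crosses {n} (Tg : tanglegram n) (XY : seq 'I_n * seq 'I_n)
    (i j : 'I_n) : bool :=
  let phi := tgphi Tg in
  (before XY.1 i j && before XY.2 (phi j) (phi i)) ||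
  (before XY.1 j i && before XY.2 (phi i) (phi j)).

Definition planar_layout {n} (Tg : tanglegram n)
    (XY : seq 'I_n * seq 'I_n) : Prop :=
  layout Tg XY /\ forall i j : 'I_n, ~~ crosses Tg XY i j.

Definition planar {n} (Tg : tanglegram n) : Prop :=
  exists XY, planar_layout Tg XY.

Definition leaf_matched {n} (Tg : tanglegram n) (u v : btree n) : Prop :=
  [/\ u \in vertices (tgT Tg), internal u,
      v \in vertices (tgS Tg), internal v
    & forall i, (i \in Lf u) = (tgphi Tg i \in Lf v)].

Definition flip {n} (w : btree n) (X X' : seq 'I_n) : Prop :=
  exists p m q, [/\ X = p ++ m ++ q, perm_eq m (Lf w) & X' = p ++ rev m ++ q].

Definition paired_flip {n} (Tg : tanglegram n) (u v : btree n)
    (XY XY' : seq 'I_n * seq 'I_n) : Prop :=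
  [/\ leaf_matched Tg u v, flip u XY.1 XY'.1 & flip v XY.2 XY'.2].

Definition paired_flip_in {n} (Tg : tanglegram n)
    (L : seq (btree n * btree n)) (XY XY' : seq 'I_n * seq 'I_n) : Prop :=
  exists u v, (u, v) \in L /\ paired_flip Tg u v XY XY'.

Definition linked {n} (Tg : tanglegram n) : rel (btree n) :=
  fun u v => [exists i : 'I_n, (i \in Lf u) && (tgphi Tg i \in Lf v)].

(* [stE s a b] is the edge between a in [stX s] and b in [stY s]; the list
   [stL s] is only used as a set. *)
Record state (n : nat) := State {
  stX : seq (btree n);
  stY : seq (btree n);
  stE : rel (btree n);
  stL : seq (btree n * btree n)
}.

Definition init_state {n} (Tg : tanglegram n) : state n :=
  State [:: tgT Tg] [:: tgS Tg]
        (fun a b => (a == tgT Tg) && (b == tgS Tg)) [::].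

Definition transp {A : Type} (E : rel A) : rel A := fun a b => E b a.

(* In the next four definitions, [B] is the list opposite to the one containing
   [u], and [E] is oriented so that the vertices of [B] are its second
   arguments. *)
Definition neighbors {n} (E : rel (btree n)) (B : seq (btree n))
    (u : btree n) : seq (btree n) := [seq b <- B | E u b].

Definition degree {n} (E : rel (btree n)) (B : seq (btree n))
    (u : btree n) : nat := size (neighbors E B u).

Definition refine_edges {n} (Pr E : rel (btree n)) (B : seq (btree n))
    (u u1 u2 : btree n) : rel (btree n) := fun a b =>
  (E a b && ~~ ((a == u) && (b \in B))) ||
  [&& (a == u1) || (a == u2), b \in neighbors E B u & Pr a b].

(* The two children of u, in the order in which they replace u; [E'] is the
   edge set after the refinement. *)
Definition ordered_children {n} (E' : rel (btree n)) (B : seq (btree n))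
    (u1 u2 : btree n) : seq (btree n) :=
  let k := \max_(j < size B | E' u1 (nth u1 B j)) j in
  if [forall j : 'I_(size B), E' u2 (nth u2 B j) ==> (k <= j)]
  then [:: u1; u2] else [:: u2; u1].

Definition maximal_degree {n} (s : state n) (d : nat) : Prop :=
  (forall a, a \in stX s -> internal a -> degree (stE s) (stY s) a <= d) /\
  (forall b, b \in stY s -> internal b ->
    degree (transp (stE s)) (stX s) b <= d).

Inductive step {n} (Tg : tanglegram n) (s : state n) : state n -> Prop :=
| StepT p u q u1 u2 :
    let E' := refine_edges (linked Tg) (stE s) (stY s) u u1 u2 in
    stX s = p ++ u :: q ->
    children u u1 u2 ->
    maximal_degree s (degree (stE s) (stY s) u) ->
    step Tg s (State (p ++ ordered_children E' (stY s) u1 u2 ++ q)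
                     (stY s)
                     E'
                     (if neighbors (stE s) (stY s) u is [:: v]
                      then (u, v) :: stL s else stL s))
| StepS p u q u1 u2 :
    let E' := refine_edges (transp (linked Tg)) (transp (stE s)) (stX s) u u1 u2 in
    stY s = p ++ u :: q ->
    children u u1 u2 ->
    maximal_degree s (degree (transp (stE s)) (stX s) u) ->
    step Tg s (State (stX s)
                     (p ++ ordered_children E' (stX s) u1 u2 ++ q)
                     (transp E')
                     (if neighbors (transp (stE s)) (stX s) u is [:: v]
                      then (v, u) :: stL s else stL s)).

(* The algorithm is nondeterministic (choice of the vertex of highest degree,
   naming of its children): this says that X, Y, L is the output of some run.
   The run ends when only leaves remain in both lists. *)
Definition modified_untangle {n} (Tg : tanglegram n) (X Y : seq 'I_n)
    (L : seq (btree n * btree n)) : Prop :=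
  exists s : state n,
    [/\ clos_refl_trans _ (step Tg) (init_state Tg) s,
        stX s = [seq Leaf i | i <- X], stY s = [seq Leaf i | i <- Y]
      & stL s = L].

(* Main.v *)
Require Import Defs.

Set Implicit Arguments.
Unset Strict Implicit.
Unset Printing Implicit Defensive.

(** Two orders of the leaves have no crossing exactly when the order on the
    second tree is the image under [phi] of the order on the first, so a planar
    layout is a single list [Z], drawn below both trees as [Z] and [map phi Z].

    Fix a planar layout and follow a run of the algorithm.  The lists [stX] and
    [stY] are horizontal cuts through the trees, and the claim is that paired
    flips at the pairs recorded so far bring the fixed layout to a [Z] that is
    compatible with both cuts: [Z] is a concatenation of drawings of the
    vertices in [stX], in their order, and [map phi Z] likewise for [stY].

    Refining a vertex [u] preserves this ([step_tracks]).  In [Z] the leaves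
    below one child of [u] precede those below the other; since there are no
    crossings, the neighbors of the first child then come weakly before those
    of the second ([linked_order]).  If [u] has degree at least two, this
    determines the order of the children, and the test made by the algorithm
    finds it.  A wrong order can therefore only occur when [u] has a single
    neighbor [v] ([refine_forest]).  In that case all internal vertices have
    degree at most one, because [u] was chosen of highest degree, hence [u] and
    [v] are leaf-matched ([sole_edge_matched]), the pair has just been recorded,
    and flipping it corrects the order without introducing a crossing
    ([flip_matched]).

    At the end both cuts consist of leaves, so [Z] is the output of the
    algorithm.  Thus the fixed layout leads to the output by recorded paired
    flips, and these flips are reversible. *)

(** * Leaf orders drawn recursively *)

Section Drawings.

Variable n : nat.
Implicit Types (t u v w : btree n) (ts : seq (btree n)) (X Y Z : seq 'I_n).

(** The same orders as in [tree_layout] (see [tree_layout_drawing]), but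
    generated from the root.  This form restricts to subtrees and is visibly
    stable under reversal. *)
Fixpoint drawing t X : Prop :=
  match t with
  | Leaf i => X = [:: i]
  | Node l r =>
      exists A B, [/\ drawing l A, drawing r B & X = A ++ B \/ X = B ++ A]
  end.

Fixpoint forest_drawing ts X : Prop :=
  match ts with
  | [::] => X = [::]
  | t :: ts' =>
      exists A X', [/\ drawing t A, forest_drawing ts' X' & X = A ++ X']
  end.

Lemma drawing_perm t X : drawing t X -> perm_eq X (Lf t).
Proof.
elim: t X => [i | l IHl r IHr] X /=; first by move=> ->.
move=> [A [B [/IHl pA /IHr pB [] ->]]]; first exact: perm_cat.
by rewrite perm_catC perm_cat.
Qed.

Lemma drawing_rev t X : drawing t X -> drawing t (rev X).
Proof.
elim: t X => [i | l IHl r IHr] X /=; first by move=> ->.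
move=> [A [B [/IHl dA /IHr dB eX]]]; exists (rev A), (rev B); split=> //.
by case: eX => ->; rewrite rev_cat; [right | left].
Qed.

Lemma drawing_children u u1 u2 X :
    children u u1 u2 -> drawing u X ->
  exists A1 A2, [/\ drawing u1 A1, drawing u2 A2 & X = A1 ++ A2 \/ X = A2 ++ A1].
Proof.
case/orP=> /eqP-> [A [B [dA dB eX]]]; first by exists A, B.
by exists B, A; split=> //; case: eX; [right | left].
Qed.

Lemma mem_Lf_children u u1 u2 i :
  children u u1 u2 -> (i \in Lf u) = (i \in Lf u1) || (i \in Lf u2).
Proof. by case/orP=> /eqP->; rewrite mem_cat // orbC. Qed.

Lemma Lf_inhabited t : exists i, i \in Lf t.
Proof.
elim: t => [i | l [i il] r _]; first by exists i; rewrite mem_head.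
by exists i; rewrite mem_cat il.
Qed.

Lemma vertices_refl t : t \in vertices t.
Proof. by case: t => *; rewrite mem_head. Qed.

Lemma vertices_children t u u1 u2 :
  u \in vertices t -> children u u1 u2 ->
  (u1 \in vertices t) && (u2 \in vertices t).
Proof.
elim: t => [i | l IHl r IHr] /=; rewrite inE.
  by move/eqP=> ->; rewrite /children => /orP[] /eqP.
case/orP=> [/eqP-> | ].
  by rewrite /children => /orP[] /eqP[-> ->]; rewrite !inE !mem_cat !vertices_refl !orbT.
rewrite mem_cat => /orP[ul | ur] cu.
  by have /andP[v1 v2] := IHl ul cu; rewrite !inE !mem_cat v1 v2 !orbT.
by have /andP[v1 v2] := IHr ur cu; rewrite !inE !mem_cat v1 v2 !orbT.
Qed.

(** Filtering cuts a layout down to the leaves below one child of the root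
    while keeping the consecutive blocks inside. *)
Lemma consecutive_filter (A : eqType) (P : pred A) (s X : seq A) :
  all P s -> consecutive s X -> consecutive s (filter P X).
Proof.
move=> Ps [p [m [q [-> pm]]]]; exists (filter P p), m, (filter P q).
have /all_filterP fm : all P m by rewrite (perm_all _ pm).
by rewrite !filter_cat fm.
Qed.

Lemma mem_Lf_vertex t w i : w \in vertices t -> i \in Lf w -> i \in Lf t.
Proof.
elim: t => [j | l IHl r IHr] /=; first by rewrite inE => /eqP->.
rewrite inE mem_cat => /or3P[/eqP-> // | wl | wr] iw.
  by rewrite mem_cat IHl.
by rewrite mem_cat IHr // orbT.
Qed.

Lemma tree_layout_sub t t' X X1 :
    tree_layout t X -> perm_eq X1 (Lf t') ->
    {subset vertices t' <= vertices t} ->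
    filter (mem X1) X = X1 ->
  tree_layout t' X1.
Proof.
move=> [_ cX] p1 sub fX; split=> // w wt'.
rewrite -fX; apply: consecutive_filter; last exact/cX/sub.
by apply/allP=> i iw /=; rewrite (perm_mem p1) (mem_Lf_vertex wt').
Qed.

(** The leaves of the two subtrees of the root form two consecutive blocks that
    cover the whole list, so one of them is an initial segment and the other is
    the rest; each block is again a layout of its subtree. *)
Lemma tree_layout_drawing t X : uniq (Lf t) -> tree_layout t X -> drawing t X.
Proof.
elim: t X => [i | l IHl r IHr] X ut lX.
  by case: lX => /perm_small_eq->.
have [pX cX] := lX; have uX: uniq X by rewrite (perm_uniq pX).
have /andP[vl vr] := vertices_children (vertices_refl (Node l r))
  (introT orP (or_introl (eqxx _)) : children (Node l r) l r).
have [p [m [q [eX pm]]]] := cX l vl.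
have [p' [m' [q' [eX' pm']]]] := cX r vr.
have ppq: perm_eq (p ++ q) (Lf r).
  rewrite -(perm_cat2l (Lf l)); apply: perm_trans pX.
  by rewrite eX perm_sym perm_catCA perm_cat2r.
have ppq': perm_eq (p' ++ q') (Lf l).
  rewrite -(perm_cat2r (Lf r)); apply: perm_trans pX.
  by rewrite eX' -catA perm_cat2l perm_catC perm_cat2r perm_sym.
have split_draw A B : X = A ++ B \/ X = B ++ A ->
    perm_eq A (Lf l) -> perm_eq B (Lf r) -> drawing (Node l r) X.
  move=> eAB pA pB.
  have pAB : perm_eq X (A ++ B) by case: eAB => ->; rewrite // perm_catC.
  have uAB : uniq (A ++ B) by rewrite -(perm_uniq pAB).
  move: (uAB); rewrite cat_uniq => /and3P[_ /hasPn dBA _].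
  have fA s : {subset s <= B} -> filter (mem A) s = [::].
    by move=> sB; apply/eqP; rewrite -(negbK (_ == _)) -has_filter;
      apply/hasPn => x /sB; apply: dBA.
  have fB s : {subset s <= A} -> filter (mem B) s = [::].
    move=> sB; apply/eqP; rewrite -(negbK (_ == _)) -has_filter.
    by apply/hasPn => x /sB xA; apply/negP=> /dBA /negP.
  have id s : filter (mem s) s = s by apply/all_filterP/allP.
  exists A, B; split=> //.
    apply: IHl; first by move: ut; rewrite /= cat_uniq => /andP[].
    apply: (tree_layout_sub lX pA) => [w wl | ].
      by rewrite inE mem_cat wl orbT.
    by case: eAB => ->; rewrite filter_cat id fA ?cats0.
  apply: IHr; first by move: ut; rewrite /= cat_uniq => /and3P[].
  apply: (tree_layout_sub lX pB) => [w wl | ].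
    by rewrite inE mem_cat wl !orbT.
  by case: eAB => ->; rewrite filter_cat id fB ?cats0.
(* If the block of [l] is not at the top of [X], the first leaf of [X] belongs
   to [r], so the block of [r] is at the top. *)
case: p eX ppq => [|x p] eX ppq; first by apply: (split_draw m q) => //; left.
case: p' eX' ppq' => [|y p'] eX' ppq'.
  by apply: (split_draw q' m') => //; right.
have xr: x \in Lf r by rewrite -(perm_mem ppq) mem_head.
have xl: x \in Lf l.
  rewrite -(perm_mem ppq'); move: eX'; rewrite eX => -[-> _].
  exact: mem_head.
by move: ut; rewrite /= cat_uniq => /and3P[_ /hasPn/(_ x xr)]; rewrite /= xl.
Qed.

Lemma forest_drawing_cat ts1 ts2 X :
  forest_drawing (ts1 ++ ts2) X <->
  exists X1 X2, [/\ forest_drawing ts1 X1, forest_drawing ts2 X2 & X = X1 ++ X2].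
Proof.
elim: ts1 X => [|t ts1 IH] X /=.
  by split=> [dX | [X1 [X2 [-> ? ->]]] //]; exists [::], X.
split=> [[A [X' [dA /IH[X1 [X2 [d1 d2 ->]]] ->]]] | ].
  by exists (A ++ X1), X2; rewrite catA; split=> //; exists A, X1.
move=> [_ [X2 [[A [X1 [dA d1 ->]]] d2 ->]]].
by exists A, (X1 ++ X2); rewrite catA; split=> //; apply/IH; exists X1, X2.
Qed.

Lemma forest_drawing_mid ts1 u ts2 X :
  forest_drawing (ts1 ++ u :: ts2) X <->
  exists X1 m X2, [/\ forest_drawing ts1 X1, drawing u m,
                      forest_drawing ts2 X2 & X = X1 ++ m ++ X2].
Proof.
split=> [/forest_drawing_cat[X1 [_ [d1 [m [X2 [dm d2 ->]]] ->]]] | ].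
  by exists X1, m, X2.
move=> [X1 [m [X2 [d1 dm d2 ->]]]]; apply/forest_drawing_cat.
by exists X1, (m ++ X2); split=> //; exists m, X2.
Qed.

Lemma forest_drawing_mid2 ts1 u w ts2 X1 A B X2 :
    forest_drawing ts1 X1 -> drawing u A -> drawing w B ->
    forest_drawing ts2 X2 ->
  forest_drawing (ts1 ++ [:: u; w] ++ ts2) (X1 ++ (A ++ B) ++ X2).
Proof.
move=> d1 dA dB d2; apply/forest_drawing_mid.
by exists X1, A, (B ++ X2); rewrite -!catA; split=> //; exists B, X2.
Qed.

Lemma mem_forest_drawing ts X i :
  forest_drawing ts X -> (i \in X) = has (fun t => i \in Lf t) ts.
Proof.
elim: ts X => [|t ts IH] X /=; first by move=> ->.
by case=> A [X' [/drawing_perm/perm_mem dA /IH dX' ->]]; rewrite mem_cat dX' dA.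
Qed.

(** Every tree contributes at least one leaf, so a repeated tree would repeat a
    leaf. *)
Lemma forest_drawing_uniq ts X : uniq X -> forest_drawing ts X -> uniq ts.
Proof.
elim: ts X => [|t ts IH] X uX //= [A [X' [dA dX' eX]]].
move: uX; rewrite eX cat_uniq => /and3P[_ /hasPn disj uX'].
rewrite (IH X') // andbT; apply/negP=> tts.
have [i it] := Lf_inhabited t.
have /disj/negP[] : i \in X'.
  by rewrite (mem_forest_drawing _ dX'); apply/hasP; exists t.
by rewrite /= (perm_mem (drawing_perm dA)).
Qed.

Lemma before_cat X1 X2 a b :
  uniq (X1 ++ X2) -> a \in X1 -> b \in X2 -> before (X1 ++ X2) a b.
Proof.
rewrite cat_uniq => /and3P[_ /hasPn disj _] aX bX.
rewrite /before !index_cat aX (negbTE (disj b bX)).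
by apply: leq_trans (leq_addr _ _); rewrite index_mem.
Qed.

Lemma before_forest_drawing x0 ts X a b j1 j2 :
    uniq X -> forest_drawing ts X -> before X a b ->
    j1 < size ts -> j2 < size ts ->
    a \in Lf (nth x0 ts j1) -> b \in Lf (nth x0 ts j2) ->
  j1 <= j2.
Proof.
move=> uX dX bab j1s j2s aj bj; rewrite leqNgt; apply/negP=> ltj.
move: dX; rewrite -(cat_take_drop j1 ts).
case/forest_drawing_cat=> X1 [X2 [d1 d2 eX]].
have bX1 : b \in X1.
  rewrite (mem_forest_drawing _ d1); apply/hasP; exists (nth x0 ts j2) => //.
  by rewrite -(nth_take _ ltj) mem_nth // size_takel // ltnW.
have aX2 : a \in X2.
  rewrite (mem_forest_drawing _ d2); apply/hasP; exists (nth x0 ts j1) => //.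
  by rewrite -{1}[j1]addn0 -nth_drop mem_nth // size_drop subn_gt0.
move: uX bab; rewrite eX => uX; rewrite /before ltnNge ltnW //.
exact: before_cat.
Qed.

(** A nonempty block starts at the first position holding one of its elements,
    which makes its place depend on its contents only. *)
Lemma block_unique (A : eqType) (p m q p' m' q' : seq A) :
    uniq (p ++ m ++ q) -> p ++ m ++ q = p' ++ m' ++ q' -> perm_eq m m' ->
    m != [::] ->
  [/\ p = p', m = m' & q = q'].
Proof.
move=> upmq epmq pm m0.
have size_find (x y z : seq A) : uniq (x ++ y ++ z) -> y != [::] ->
    size x = find (mem y) (x ++ y ++ z).
  rewrite cat_uniq => /and3P[_ /hasPn disj _] y0.
  rewrite find_cat; case: ifP => [/hasP[a ax ay] | _].
    have /disj/negP[] : a \in y ++ z by rewrite mem_cat; apply/orP; left.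
    exact: ax.
  by case: y y0 {disj} => // a y _; rewrite /= mem_head addn0.
have szp : size p = size p'.
  rewrite (size_find p m q) // (size_find p' m' q') -?epmq //.
    by apply: eq_find => a /=; rewrite (perm_mem pm).
  by rewrite -size_eq0 -(perm_size pm) size_eq0.
move/eqP: epmq; rewrite eqseq_cat // => /andP[/eqP-> ].
by rewrite eqseq_cat ?(perm_size pm) // => /andP[/eqP-> /eqP->].
Qed.

Lemma sorted_before (A : eqType) (X : seq A) : uniq X -> sorted (before X) X.
Proof.
move=> uX; case: X uX => [//|a X'] uX; apply/(sortedP a) => i iX.
by rewrite /before !index_uniq // ltnW.
Qed.

(** [Y] and [map phi X] have the same entries, and both are increasing for the
    position in [Y]. *)
Lemma noncrossing_map (phi : {perm 'I_n}) X Y :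
    uniq X -> uniq Y -> perm_eq Y (map phi X) ->
    (forall i j, before X i j -> ~~ before Y (phi j) (phi i)) ->
  Y = map phi X.
Proof.
move=> uX uY pY nc; apply: (@irr_sorted_eq _ (before Y)).
- by move=> b a c; apply: ltn_trans.
- by move=> a; rewrite /before ltnn.
- exact: sorted_before.
- have /sorted_before := uX; rewrite sorted_map.
  (* Distinct entries have distinct indices, so a pair that does not cross
     keeps its order. *)
  have sX : {in X &, subrel (before X) (relpre phi (before Y))}.
    move=> i j iX jX bij /=; have := nc i j bij.
    rewrite /before -leqNgt leq_eqVlt => /predU1P[eij | //].
    have inY k : k \in X -> phi k \in Y by move=> kX; rewrite (perm_mem pY) map_f.
    have /perm_inj ij : phi i = phi j.
      by rewrite -(nth_index i (inY i iX)) eij nth_index ?inY.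
    by move: bij; rewrite ij /before ltnn.
  by apply: sub_in_sorted (allss X).
- exact: perm_mem.
Qed.

End Drawings.

(** * Refining one vertex *)

(** Refinements in the two trees are mirror images of each other, so they are
    treated together: [A] is the list of the refined vertex, [B] the opposite
    one, and [f] sends leaves below [A] to leaves below [B]; it stands for
    [phi] or for its inverse. *)
Section Refinement.

Variables (n : nat) (f : {perm 'I_n}).
Implicit Types (a b t u v w : btree n) (A B : seq (btree n)) (X Y Z : seq 'I_n).
Implicit Types E Pr : rel (btree n).

Definition linked_by : rel (btree n) :=
  fun u v => [exists i : 'I_n, (i \in Lf u) && (f i \in Lf v)].

Lemma uniq_map_perm Z : uniq (map f Z) = uniq Z.
Proof. by rewrite map_inj_uniq //; apply: perm_inj. Qed.

Lemma linked_by_children u u1 u2 b :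
  children u u1 u2 -> linked_by u b = linked_by u1 b || linked_by u2 b.
Proof.
move=> cu; apply/existsP/orP=> [[i] | [] /existsP[i /andP[iu ib]]].
- rewrite (mem_Lf_children _ cu) andb_orl.
  by case/orP=> h; [left | right]; apply/existsP; exists i.
- by exists i; rewrite (mem_Lf_children _ cu) iu ib.
- by exists i; rewrite (mem_Lf_children _ cu) iu ib orbT.
Qed.

Definition links_between E Pr A B : Prop :=
  forall a b, E a b = [&& a \in A, b \in B & Pr a b].

Lemma ordered_children_perm E B u1 u2 :
  perm_eq (ordered_children E B u1 u2) [:: u1; u2].
Proof.
rewrite /ordered_children; case: ifP => // _.
by rewrite (perm_catC [:: u2] [:: u1]).
Qed.

Lemma children_neq u u1 u2 : children u u1 u2 -> (u != u1) && (u != u2).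
Proof.
have node_neq (l r : btree n) : (Node l r != l) && (Node l r != r).
  apply/andP; split; apply/eqP=> /(congr1 (fun t => size (vertices t)))/eqP.
    by rewrite /= size_cat gtn_eqF // ltnS leq_addr.
  by rewrite /= size_cat gtn_eqF // ltnS leq_addl.
by case/orP=> /eqP->; last rewrite andbC; apply: node_neq.
Qed.

(** The new edges are restricted to neighbors of [u]; no link is lost, since a
    vertex linked to a child of [u] is linked to [u]. *)
Lemma refine_edges_links Pr E p u q B u1 u2 c :
    uniq (p ++ u :: q) -> children u u1 u2 -> Pr =2 linked_by ->
    links_between E Pr (p ++ u :: q) B -> perm_eq c [:: u1; u2] ->
  links_between (refine_edges Pr E B u u1 u2) Pr (p ++ c ++ q) B.
Proof.
move=> uA cu ePr eE pc a b.
have uin : u \in p ++ u :: q by rewrite mem_cat mem_head orbT.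
rewrite /refine_edges mem_filter !eE uin !mem_cat (perm_mem pc) !inE /=.
have upq : u \notin p ++ q.
  by move: uA; rewrite uniq_catC /= mem_cat orbC -mem_cat => /andP[].
have Pru b' : Pr u b' = Pr u1 b' || Pr u2 b'.
  by rewrite !ePr (linked_by_children _ cu).
case bB: (b \in B); rewrite /= ?andbF ?andbT //.
case: (eqVneq a u) => [-> | nau] /=.
  have /andP[/negbTE-> /negbTE->] := children_neq cu.
  by move: upq; rewrite mem_cat negb_or => /andP[/negbTE-> /negbTE->]; rewrite andbF.
rewrite Pru andbT.
case: (eqVneq a u1) => [-> | _] /=; first by case: (Pr u1 b); rewrite ?andbF ?orbT.
case: (eqVneq a u2) => [-> | _] /=; first by case: (Pr u2 b); rewrite ?andbF ?orbT.
by rewrite orbF.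
Qed.

(** The leaves matched with those of [u] are exactly those of [v], so [v]
    occupies in [map f Z] the image of the block of [u], and reversing the block
    of [u] in [Z] reverses the block of [v] in [map f Z]: the flipped pair is
    again free of crossings. *)
Lemma flip_matched u v B Zp Zm Zq (Z := Zp ++ Zm ++ Zq)
    (Z' := Zp ++ rev Zm ++ Zq) :
    uniq Z -> drawing u Zm -> forest_drawing B (map f Z) -> v \in B ->
    (forall i, (i \in Lf u) = (f i \in Lf v)) ->
  forest_drawing B (map f Z') /\ flip v (map f Z) (map f Z').
Proof.
move=> uZ du dB /splitPr vB uv.
case: vB dB => B1 B2 /forest_drawing_mid[Y1 [Ym [Y2 [d1 dm d2 eY]]]].
have ufZ : uniq (map f Z) by rewrite uniq_map_perm.
have pm : perm_eq (map f Zm) Ym.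
  apply: uniq_perm.
  - by move: ufZ; rewrite !map_cat !cat_uniq => /and3P[_ _ /andP[]].
  - by move: ufZ; rewrite eY !cat_uniq => /and3P[_ _ /andP[]].
  move=> k; rewrite (perm_mem (drawing_perm dm)) -[k](permKV f).
  by rewrite mem_map -?uv ?(perm_mem (drawing_perm du)) //; apply: perm_inj.
have Zm0 : map f Zm != [::].
  have [i iu] := Lf_inhabited u; move: iu.
  by rewrite -(perm_mem (drawing_perm du)); case: (Zm).
have [e1 em e2] : [/\ map f Zp = Y1, map f Zm = Ym & map f Zq = Y2].
  by apply: block_unique => //; rewrite -!map_cat.
split.
  apply/forest_drawing_mid; exists Y1, (rev Ym), Y2; split=> //.
    exact: drawing_rev.
  by rewrite /Z' !map_cat map_rev e1 em e2.
exists Y1, Ym, Y2; split=> //; first exact: drawing_perm.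
by rewrite /Z' !map_cat map_rev e1 em e2.
Qed.

Lemma matched_vertex A B Z a i :
    forest_drawing A Z -> forest_drawing B (map f Z) -> a \in A ->
    i \in Lf a ->
  exists2 b, b \in B & f i \in Lf b.
Proof.
move=> dA dB aA ia; apply/hasP; rewrite -(mem_forest_drawing _ dB).
by apply: map_f; rewrite (mem_forest_drawing _ dA); apply/hasP; exists a.
Qed.

Lemma small_seq_eq (T : eqType) (s : seq T) x y :
  size s <= 1 -> x \in s -> y \in s -> x = y.
Proof. by case: s => [|z []] //=; rewrite !inE => _ /eqP-> /eqP->. Qed.

(** All leaves of [u] are matched into [v] because [v] is the sole neighbor.
    Conversely, a leaf of [v] matched outside [u] would give [v] a second
    neighbor, against the bound on degrees; that bound concerns internal
    vertices, so [v] must be shown not to be a leaf. *)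
Lemma sole_edge_matched Pr E A B u v Z :
    uniq Z -> forest_drawing A Z -> forest_drawing B (map f Z) ->
    Pr =2 linked_by -> links_between E Pr A B ->
    u \in A -> internal u -> neighbors E B u = [:: v] ->
    (forall b, b \in B -> internal b -> degree (transp E) A b <= 1) ->
  [/\ v \in B, internal v & forall i, (i \in Lf u) = (f i \in Lf v)].
Proof.
move=> uZ dA dB ePr eE uA iu nu maxd.
have vB : v \in B.
  by have := mem_head v [::]; rewrite -nu mem_filter => /andP[].
have uv i : i \in Lf u -> f i \in Lf v.
  move=> iLu; have [b bB fib] := matched_vertex dA dB uA iLu.
  have : b \in neighbors E B u.
    rewrite mem_filter eE uA bB ePr /= andbT.
    by apply/existsP; exists i; rewrite iLu.
  by rewrite nu inE => /eqP <-.
have iv : internal v.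
  (* A leaf [v] would be matched with a single leaf, but [u] has two. *)
  case: v {nu vB} uv => // k uk; case: u iu uA uk => // l r _ lrA uk.
  have [[i il] [j jr]] := (Lf_inhabited l, Lf_inhabited r).
  have : f i = f j.
    have /[!inE]/eqP-> : f i \in Lf (Leaf k) by apply: uk; rewrite mem_cat il.
    apply/esym/eqP; rewrite -mem_seq1; apply: uk.
    by rewrite mem_cat jr orbT.
  move/perm_inj=> eij; case/splitPr: lrA dA => A1 A2.
  case/forest_drawing_mid=> X1 [m [X2 [_ [ml [mr [dl dr em]]] _ eZ]]].
  move: uZ; rewrite eZ !cat_uniq => /and3P[_ _ /and3P[um _ _]].
  have : uniq (ml ++ mr) by case: em um => -> //; rewrite uniq_catC.
  rewrite cat_uniq => /and3P[_ /hasPn/(_ j)]; rewrite -eij /=.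
  rewrite (perm_mem (drawing_perm dr)) eij jr -eij.
  by rewrite (perm_mem (drawing_perm dl)) il => /(_ isT).
split=> // i; apply/idP/idP=> [/uv // | fiv].
have : i \in Z.
  rewrite -(mem_map (@perm_inj _ f)) (mem_forest_drawing _ dB).
  by apply/hasP; exists v.
rewrite (mem_forest_drawing _ dA) => /hasP[a aA ia].
suff -> : u = a by [].
apply: small_seq_eq (maxd v vB iv) _ _; rewrite mem_filter /transp.
  by have := mem_head v [::]; rewrite -nu mem_filter => /andP[->].
by rewrite eE aA vB ePr !andbT; apply/existsP; exists i; rewrite ia.
Qed.

(** This is where the absence of crossings is used: leaves of [u1] precede those
    of [u2] in [Z], hence so do their images, and with them the trees of [B]
    that contain these images. *)
Lemma linked_order x0 B u1 u2 (Zp m1 m2 Zq : seq 'I_n) j1 j2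
    (Z := Zp ++ (m1 ++ m2) ++ Zq) :
    uniq Z -> drawing u1 m1 -> drawing u2 m2 -> forest_drawing B (map f Z) ->
    j1 < size B -> j2 < size B ->
    linked_by u1 (nth x0 B j1) -> linked_by u2 (nth x0 B j2) ->
  j1 <= j2.
Proof.
move=> uZ d1 d2 dB j1B j2B /existsP[i /andP[iu1 fi]] /existsP[j /andP[ju2 fj]].
apply: (@before_forest_drawing _ x0 B (map f Z) (f i) (f j)) => //.
  by rewrite uniq_map_perm.
rewrite /before !index_map; try exact: perm_inj.
have eZ : Z = (Zp ++ m1) ++ (m2 ++ Zq) by rewrite /Z -!catA.
rewrite eZ; apply: before_cat; rewrite -?eZ //.
  by rewrite mem_cat (perm_mem (drawing_perm d1)) iu1 orbT.
by rewrite mem_cat (perm_mem (drawing_perm d2)) ju2.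
Qed.

(** If [Z] has [u1] first, [linked_order] is precisely the test that places
    [u1] first.  If [Z] has [u2] first and the test still places [u1] first,
    then no neighbor of [u1] is before or after a neighbor of [u2], so both
    children have the same sole neighbor; reversing the block of [u] then gives
    the order chosen. *)
Lemma refine_forest Pr E B p u q u1 u2 Z
    (c := ordered_children (refine_edges Pr E B u u1 u2) B u1 u2) :
    uniq Z -> forest_drawing (p ++ u :: q) Z -> forest_drawing B (map f Z) ->
    children u u1 u2 -> Pr =2 linked_by ->
    links_between E Pr (p ++ u :: q) B ->
  forest_drawing (p ++ c ++ q) Z \/
  exists v Zp Zm Zq,
    [/\ neighbors E B u = [:: v], Z = Zp ++ Zm ++ Zq, drawing u Zm
      & forest_drawing (p ++ c ++ q) (Zp ++ rev Zm ++ Zq)].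
Proof.
move=> uZ dA dB cu ePr eE.
have uA := forest_drawing_uniq uZ dA.
have uB : uniq B by apply: forest_drawing_uniq dB; rewrite uniq_map_perm.
have uin : u \in p ++ u :: q by rewrite mem_cat mem_head orbT.
have eE' := refine_edges_links uA cu ePr eE
  (ordered_children_perm (refine_edges Pr E B u u1 u2) B u1 u2).
have eE1 j : j < size B ->
    refine_edges Pr E B u u1 u2 u1 (nth u1 B j) = linked_by u1 (nth u1 B j).
  move=> jB; rewrite eE' !mem_cat (perm_mem (ordered_children_perm _ _ _ _)).
  by rewrite mem_head orbT mem_nth // ePr.
have eE2 j : j < size B ->
    refine_edges Pr E B u u1 u2 u2 (nth u2 B j) = linked_by u2 (nth u2 B j).
  move=> jB; rewrite eE' !mem_cat (perm_mem (ordered_children_perm _ _ _ _)).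
  by rewrite inE mem_head !orbT mem_nth // ePr.
have [Zp [Zm [Zq [dp dm dq eZ]]]] := (forest_drawing_mid _ _ _ _).1 dA.
have [A1 [A2 [d1 d2 [em | em]]]] := drawing_children cu dm.
  left; rewrite eZ em in uZ dB *.
  suff -> : c = [:: u1; u2] by apply: forest_drawing_mid2.
  rewrite /c /ordered_children; case: forallP => // -[] [j jB]; apply/implyP.
  rewrite eE2 // => l2; apply/bigmax_leqP=> i; rewrite eE1 // => l1.
  rewrite (set_nth_default u1) // in l2.
  exact: (linked_order uZ d1 d2 dB (ltn_ord i) jB l1 l2).
(* Here [Z] has [u2] first. *)
rewrite /c /ordered_children; case: forallP => [ord | _].
  right; have [uZ' dB'] := (uZ, dB); rewrite eZ em in uZ' dB'.
  have same j1 j2 : j1 < size B -> j2 < size B -> linked_by u1 (nth u1 B j1) ->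
      linked_by u2 (nth u1 B j2) -> j1 = j2.
    move=> j1B j2B l1 l2; apply/eqP; rewrite eqn_leq.
    rewrite (linked_order uZ' d2 d1 dB' j2B j1B l2 l1) andbT.
    rewrite (set_nth_default u2) // in l2.
    have /implyP := ord (Ordinal j2B); rewrite eE2 // => /(_ l2).
    apply: leq_trans.
    by apply: leq_bigmax_cond (Ordinal j1B) _; rewrite eE1.
  have ulink w : w = u1 \/ w = u2 ->
      exists2 j, j < size B & linked_by w (nth u1 B j).
    move=> ew; have [i iw] := Lf_inhabited w.
    have iu : i \in Lf u.
      by rewrite (mem_Lf_children _ cu); case: ew iw => -> ->; rewrite ?orbT.
    have [b bB fib] := matched_vertex dA dB uin iu.
    exists (index b B); first by rewrite index_mem.
    by rewrite nth_index //; apply/existsP; exists i; rewrite iw.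
  have [j1 j1B l1] := ulink u1 (or_introl erefl).
  have [j2 j2B l2] := ulink u2 (or_intror erefl).
  exists (nth u1 B j1), Zp, (A2 ++ A1), Zq; split=> //.
  - apply: perm_small_eq => //; apply: uniq_perm => //; first exact: filter_uniq.
    move=> b; rewrite mem_filter eE mem_cat mem_head orbT ePr inE /=.
    apply/andP/eqP=> [[/andP[bB lb] _] | ->]; last first.
      by rewrite mem_nth // (linked_by_children _ cu) l1.
    move: lb; rewrite (linked_by_children _ cu) -{1 2}(nth_index u1 bB).
    case/orP=> lb.
      rewrite -(nth_index u1 bB) (same _ j2 _ _ lb) ?index_mem //.
      by rewrite (same j1 j2).
    by rewrite (same j1 (index b B)) ?index_mem // nth_index.
  - by rewrite -em.
  - by rewrite -em.
  - by rewrite rev_cat; apply: forest_drawing_mid2 => //; apply: drawing_rev.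
by left; rewrite eZ em; apply: forest_drawing_mid2.
Qed.

Lemma refine_step Pr E B p u q u1 u2 Z
    (c := ordered_children (refine_edges Pr E B u u1 u2) B u1 u2) :
    uniq Z -> forest_drawing (p ++ u :: q) Z -> forest_drawing B (map f Z) ->
    children u u1 u2 -> Pr =2 linked_by ->
    links_between E Pr (p ++ u :: q) B ->
    (forall b, b \in B -> internal b ->
       degree (transp E) (p ++ u :: q) b <= degree E B u) ->
  forest_drawing (p ++ c ++ q) Z \/
  exists v Z',
    [/\ neighbors E B u = [:: v], v \in B, internal v
      & forall i, (i \in Lf u) = (f i \in Lf v)] /\
    [/\ flip u Z Z', flip v (map f Z) (map f Z'), uniq Z',
        forest_drawing (p ++ c ++ q) Z' & forest_drawing B (map f Z')].
Proof.
move=> uZ dA dB cu ePr eE maxd.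
have [|[v [Zp [Zm [Zq [nu eZ dm dc]]]]]] := refine_forest uZ dA dB cu ePr eE.
  by left.
right; exists v, (Zp ++ rev Zm ++ Zq).
have uin : u \in p ++ u :: q by rewrite mem_cat mem_head orbT.
have iu : internal u by case/orP: cu => /eqP->.
move: maxd; rewrite {2}/degree nu => maxd.
have [vB iv uv] := sole_edge_matched uZ dA dB ePr eE uin iu nu maxd.
split=> //; rewrite {}eZ in uZ dB *.
have [dB' fl] := flip_matched uZ dm dB vB uv.
split=> //; first by exists Zp, Zm, Zq; split=> //; apply: drawing_perm.
rewrite (@perm_uniq _ _ (Zp ++ Zm ++ Zq)) // perm_cat2l perm_cat2r.
by rewrite perm_rev.
Qed.

End Refinement.

(** * Following a run of the algorithm *)

Section Untangling.

Variables (n : nat) (Tg : tanglegram n).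

Let phi := tgphi Tg.

Definition paired_flips L := clos_refl_trans _ (@paired_flip_in n Tg L).

(** Pairs are only ever added to the recorded set during a run. *)
Lemma paired_flips_mono L L' XY XY' :
  {subset L <= L'} -> paired_flips L XY XY' -> paired_flips L' XY XY'.
Proof.
move=> sL; elim=> [XY1 XY2 [u [v [uvL fl]]] | XY1 | XY1 XY2 XY3 _ IH1 _ IH2].
- by apply: rt_step; exists u, v; split=> //; apply: sL.
- exact: rt_refl.
- exact: rt_trans IH1 IH2.
Qed.

Lemma flip_sym (w : btree n) X X' : flip w X X' -> flip w X' X.
Proof.
move=> [p [m [q [-> pm ->]]]]; exists p, (rev m), q.
by rewrite revK perm_rev; split.
Qed.

Lemma paired_flips_sym L XY XY' :
  paired_flips L XY XY' -> paired_flips L XY' XY.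
Proof.
elim=> [XY1 XY2 [u [v [uvL [lm fu fv]]]] | XY1 | XY1 XY2 XY3 _ IH1 _ IH2].
- by apply: rt_step; exists u, v; split=> //; split=> //; apply: flip_sym.
- exact: rt_refl.
- exact: rt_trans IH2 IH1.
Qed.

(** The invariant of a run: from the planar layout [XY], flips at pairs recorded
    so far reach the crossing-free layout given by [Z], which is compatible with
    the current lists. *)
Record tracks XY (s : state n) (Z : seq 'I_n) : Prop := Tracks {
  tracks_uniq : uniq Z;
  tracks_flips : paired_flips (stL s) XY (Z, map phi Z);
  tracks_X : forest_drawing (stX s) Z;
  tracks_Y : forest_drawing (stY s) (map phi Z);
  tracks_T : {subset stX s <= vertices (tgT Tg)};
  tracks_S : {subset stY s <= vertices (tgS Tg)};
  tracks_E : links_between (stE s) (linked Tg) (stX s) (stY s)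
}.

Lemma linked_phi : linked Tg =2 linked_by phi.
Proof. by []. Qed.

Lemma linked_phiV : transp (linked Tg) =2 linked_by phi^-1.
Proof.
move=> u v; apply/existsP/existsP=> [[i /andP[iv iu]] | [i /andP[iu iv]]].
  by exists (phi i); rewrite iu permK.
by exists ((phi^-1)%g i); rewrite iv permKV.
Qed.

Lemma links_between_transp (E Pr : rel (btree n)) A B :
  links_between E Pr A B -> links_between (transp E) (transp Pr) B A.
Proof. by move=> eE a b; rewrite /transp eE andbCA. Qed.

Lemma vertices_ordered_children t p u q u1 u2 E B :
    {subset p ++ u :: q <= vertices t} -> children u u1 u2 ->
  {subset p ++ @ordered_children n E B u1 u2 ++ q <= vertices t}.
Proof.
move=> sA cu a.
have /andP[v1 v2] : (u1 \in vertices t) && (u2 \in vertices t).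
  by apply: vertices_children cu; rewrite sA // mem_cat mem_head orbT.
rewrite !mem_cat (perm_mem (ordered_children_perm _ _ _ _)) !inE.
case/or3P=> [ap | /orP[] /eqP-> // | aq]; apply: sA.
  by rewrite mem_cat ap.
by rewrite mem_cat inE aq !orbT.
Qed.

Lemma step_tracks XY s s' Z :
  step Tg s s' -> tracks XY s Z -> exists Z', tracks XY s' Z'.
Proof.
case=> [p u q u1 u2 E' eX cu [_ maxd] | p u q u1 u2 E' eY cu [maxd _]]
       [uZ fl dX dY sT sS eE].
  rewrite eX in dX sT eE maxd.
  have uX := forest_drawing_uniq uZ dX.
  have eE' := refine_edges_links uX cu linked_phi eE
    (ordered_children_perm E' (stY s) u1 u2).
  have sT' := vertices_ordered_children (E := E') (B := stY s) sT cu.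
  have [dc | [v [Z' [[nu vY iv uv] [fu fv uZ' dX' dY']]]]] :=
    refine_step uZ dX dY cu linked_phi eE maxd.
    exists Z; split=> //=; apply: paired_flips_mono fl.
    by case: neighbors => [|v [|? ?]] a aL //; rewrite inE aL orbT.
  exists Z'; split=> //=; rewrite nu.
  apply: (rt_trans _ _ _ (Z, map phi Z)); last apply: rt_step.
    by apply: paired_flips_mono fl => a aL; rewrite inE aL orbT.
  exists u, v; split; first exact: mem_head.
  split=> //; split=> //; last exact: sS.
    by apply: sT; rewrite mem_cat mem_head orbT.
  by case/orP: cu => /eqP->.
(* Refinement in the second tree is refinement along the inverse matching,
   which takes [map phi Z] back to [Z]. *)
rewrite eY in dY sS eE maxd.
have uW : uniq (map phi Z) by rewrite uniq_map_perm.
have mapV Z1 : map (phi^-1)%g (map phi Z1) = Z1.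
  by rewrite mapK //; apply: permK.
have dX' : forest_drawing (stX s) (map (phi^-1)%g (map phi Z)) by rewrite mapV.
have eEt := links_between_transp eE.
have uY := forest_drawing_uniq uW dY.
have eE' := links_between_transp (refine_edges_links uY cu linked_phiV eEt
  (ordered_children_perm E' (stX s) u1 u2)).
have sS' := vertices_ordered_children (E := E') (B := stX s) sS cu.
have [dc | [v [W [[nu vX iv uv] [fu fv uW' dW dXW]]]]] :=
  refine_step uW dY dX' cu linked_phiV eEt maxd.
  exists Z; split=> //=; apply: paired_flips_mono fl.
  by case: neighbors => [|v [|? ?]] a aL //; rewrite inE aL orbT.
have eW : map phi (map (phi^-1)%g W) = W by rewrite mapK //; apply: permKV.
exists (map (phi^-1)%g W); split; rewrite ?eW ?uniq_map_perm //= nu.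
apply: (rt_trans _ _ _ (Z, map phi Z)); last apply: rt_step.
  by apply: paired_flips_mono fl => a aL; rewrite inE aL orbT.
exists v, u; split; first exact: mem_head.
split=> //=; last by rewrite -{1}[Z]mapV.
split=> //; first exact: sT.
- by apply: sS; rewrite mem_cat mem_head orbT.
- by case/orP: cu => /eqP->.
- by move=> i; rewrite uv permK.
Qed.

Lemma tracks_init X Y :
  planar_layout Tg (X, Y) ->
  Y = map phi X /\ tracks (X, Y) (init_state Tg) X.
Proof.
move=> [[lX lY] nc]; have [/= pX _] := lX; have [/= pY _] := lY.
have uT : uniq (Lf (tgT Tg)) by rewrite (perm_uniq (tgT_labels Tg)) enum_uniq.
have uS : uniq (Lf (tgS Tg)) by rewrite (perm_uniq (tgS_labels Tg)) enum_uniq.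
have uX : uniq X by rewrite (perm_uniq pX).
have uY : uniq Y by rewrite (perm_uniq pY).
have inS i : i \in Lf (tgS Tg) by rewrite (perm_mem (tgS_labels Tg)) mem_enum.
have eY : Y = map phi X.
  apply: noncrossing_map => // [|i j ij]; last first.
    by have := nc i j; rewrite /crosses /= ij negb_or => /andP[].
  apply: uniq_perm; rewrite ?uniq_map_perm // => i.
  rewrite (perm_mem pY) inS -[i](permKV phi) mem_map; last exact: perm_inj.
  by rewrite (perm_mem pX) (perm_mem (tgT_labels Tg)) mem_enum.
split=> //; split=> //=.
- by rewrite -eY; apply: rt_refl.
- by exists X, [::]; rewrite cats0; split=> //; apply: tree_layout_drawing.
- by exists Y, [::]; rewrite cats0; split=> //; apply: tree_layout_drawing.
- by move=> a; rewrite inE => /eqP->; apply: vertices_refl.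
- by move=> a; rewrite inE => /eqP->; apply: vertices_refl.
move=> a b; rewrite /= !inE; case: eqP => // ->; case: eqP => //= ->.
have [i iT] := Lf_inhabited (tgT Tg).
by symmetry; apply/existsP; exists i; rewrite iT inS.
Qed.

Lemma run_tracks XY s0 s :
    clos_refl_trans _ (step Tg) s0 s ->
  (exists Z, tracks XY s0 Z) -> exists Z, tracks XY s Z.
Proof.
elim=> [s1 s2 st [Z] | // | s1 s2 s3 _ IH1 _ IH2 tr]; last exact/IH2/IH1.
exact: step_tracks st.
Qed.

Lemma forest_drawing_leaves (X Z : seq 'I_n) :
  forest_drawing (map Leaf X) Z -> Z = X.
Proof.
elim: X Z => [|i X IH] Z //= [A [Z' [-> /IH-> ->]]]; exact: cat1s.
Qed.

End Untangling.

Theorem theorem1p1 (n : nat) (Tg : tanglegram n) :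
  planar Tg ->
  forall (X Y : seq 'I_n) (L : seq (btree n * btree n)),
  modified_untangle Tg X Y L ->
  forall X' Y' : seq 'I_n,
  planar_layout Tg (X', Y') ->
  clos_refl_trans _ (paired_flip_in Tg L) (X, Y) (X', Y').
Proof.
move=> _ X Y L [s [run eX eY <-]] X' Y' /tracks_init[_ tr0].
have [Z [_ fl dX dY _ _ _]] := run_tracks run (ex_intro _ X' tr0).
rewrite eX in dX; rewrite eY in dY.
rewrite (forest_drawing_leaves dY) (forest_drawing_leaves dX) in fl.
exact: paired_flips_sym fl.
Qed.
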